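(* Let $d\ge 2$ and let $P$ be the $n\times n$ irreducible stochastic transition matrix of a periodic Markov chain, of the block-cyclic form $$P=\begin{bmatrix} 0 & 0 & \cdots & 0 & A_d \\ A_1 & 0 & \cdots & 0 & 0 \\ 0 & A_2 & \ddots & & \vdots \\ \vdots & \ddots & \ddots & 0 & \vdots \\ 0 & \cdots & 0 & A_{d-1} & 0 \end{bmatrix},$$ a $d\times d$ block matrix whose diagonal blocks are square of sizes $n_1,\dots,n_d$ (so $n=n_1+\cdots+n_d$), where the block in position $(i+1,i)$ is the stochastic (possibly rectangular) matrix $A_i$ of size $n_{i+1}\times n_i$ for $1\le i\le d-1$, the block in position $(1,d)$ is the stochastic matrix $A_d$ of size $n_1\times n_d$, and all other blocks are zero. Then $$\kappa(P)=d\,\kappa(A_dA_{d-1}\cdots A_1)+n-dn_1+\frac{d-1}{2}.$$ Moreover, if $n_1=\cdots=n_d$, then $$\kappa(P)=d\,\kappa(A_dA_{d-1}\cdots A_1)+\frac{d-1}{2}.$$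
   Context: A (possibly rectangular) nonnegative matrix $A$ is stochastic if $A\mathbf{1}=\mathbf{1}$, where $\mathbf{1}$ is the all-ones vector of appropriate size. The period of state $i$ of a chain with transition matrix $P$ is the gcd of all $k\ge1$ with $(P^k)_{ii}>0$; the chain is periodic if all periods are at least 2. The product $A_dA_{d-1}\cdots A_1$ is an irreducible stochastic $n_1\times n_1$ matrix. Kemeny's constant of an irreducible stochastic $N\times N$ matrix $Q$ with eigenvalues $\lambda_1=1,\lambda_2,\dots,\lambda_N$ (with algebraic multiplicity) is $\kappa(Q)=\sum_{i=2}^N\frac{1}{1-\lambda_i}$; equivalently $\kappa(Q)=\operatorname{Tr}\big((I-Q+\mathbf{1}\mathbf{h}^T)^{-1}\big)-1$ for any $\mathbf{h}$ with $\mathbf{h}^T\mathbf{1}=1$. *)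

(* Defs.v *)
From HB Require Import structures.
From mathcomp Require Import all_boot all_order all_algebra.
From mathcomp Require Import complex.

Set Implicit Arguments.
Unset Strict Implicit.
Unset Printing Implicit Defensive.

Import Order.TTheory GRing.Theory Num.Theory.
Local Open Scope ring_scope.
Local Open Scope complex_scope.

Definition stochastic (R : rcfType) (m n : nat) (A : 'M[R]_(m, n)) : Prop :=
  (forall i j, 0 <= A i j) /\ A *m (const_mx 1 : 'cV_n) = const_mx 1.

Definition irreducible (R : rcfType) (N : nat) (Q : 'M[R]_N) : Prop :=
  forall i j, exists k : nat, 0 < (Q ^+ k) i j.

(* The gcd of a possibly infinite set of integers, characterized by its
   divisors; it exists and is unique (it is 0 when the set has no element). *)
Definition is_period (R : rcfType) (N : nat) (Q : 'M[R]_N) (i : 'I_N)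
    (g : nat) : Prop :=
  forall m : nat,
    (m %| g)%N <->
    (forall k : nat, (1 <= k)%N -> 0 < (Q ^+ k) i i -> (m %| k)%N).

Definition periodic (R : rcfType) (N : nat) (Q : 'M[R]_N) : Prop :=
  forall i, exists2 g : nat, is_period Q i g & (2 <= g)%N.

Definition eigenvalues (R : rcfType) (N : nat) (Q : 'M[R]_N) : seq R[i] :=
  sval (closed_field_poly_normal (char_poly (map_mx (real_complex R) Q))).

(* [rem] deletes a single occurrence of the eigenvalue 1. *)
Definition kemeny (R : rcfType) (N : nat) (Q : 'M[R]_N) : R[i] :=
  \sum_(z <- rem 1 (eigenvalues Q)) (1 - z)^-1.

(* Block indices are counted from 0, so that [A i] stands for A_(i+1), and
   [ordS] is the cyclic successor on 'I_d.  When i = ordS j, the block has the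
   dimensions of [A j], and [conform_mx 0 (A j)] is [A j]. *)
Definition block_cyclic (R : rcfType) (d : nat) (n_ : 'I_d -> nat)
    (A : forall i : 'I_d, 'M[R]_(n_ (ordS i), n_ i)) : 'M[R]_(\sum_i n_ i) :=
  \mxblock_(i < d, j < d)
    (if i == ordS j then conform_mx (0 : 'M[R]_(n_ i, n_ j)) (A j) else 0).

(* The product A (i+k-1) * ... * A (i+1) * A i, with cyclic indices. *)
Fixpoint chain_prod (R : rcfType) (d : nat) (n_ : 'I_d -> nat)
    (A : forall i : 'I_d, 'M[R]_(n_ (ordS i), n_ i)) (i : 'I_d) (k : nat) :
    'M[R]_(n_ (iter k (@ordS d) i), n_ i) :=
  if k is k'.+1 then A (iter k' (@ordS d) i) *m chain_prod A i k' else 1%:M.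

Lemma iter_ordS (d : nat) (i : 'I_d) : iter d (@ordS d) i = i.
Proof.
apply: val_inj.
have iterE k : val (iter k (@ordS d) i) = ((i + k) %% d)%N.
  elim: k => [|k IHk]; first by rewrite addn0 modn_small.
  by rewrite iterS /= IHk -addn1 modnDml addn1 addnS.
by rewrite iterE modnDr modn_small.
Qed.

Definition cycle_prod (R : rcfType) (d : nat) (n_ : 'I_d -> nat)
    (A : forall i : 'I_d, 'M[R]_(n_ (ordS i), n_ i)) (i : 'I_d) : 'M[R]_(n_ i) :=
  castmx (congr1 n_ (iter_ordS i), erefl (n_ i)) (chain_prod A i d).

(* Main.v *)
(** If [chi] is the characteristic polynomial of a matrix with simple eigenvalue
    1, and [chi = (X - 1) q], then Kemeny's constant is the logarithmic
    derivative [q'(1) / q(1)].  Write P = N + E V, where N is the part of P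
    below the block diagonal and E V its corner block, and M for the cycle product.
    The columns W of the chain products, scaled by powers of x, satisfy
    (x - N) W = x^d E and V W = M, so x^d (x - P) = (x - N) (x^d - W V), and
    Sylvester's determinant identity gives, up to powers of X,
    chi_P(X) = X^(n - d n_1) chi_M(X^d).  Dividing by X - 1 and taking
    logarithmic derivatives at 1 yields the formula.  The eigenvalue 1 of P is
    simple by the maximum principle, and its simplicity passes to M through the
    polynomial identity. *)

Require Import Defs.
From HB Require Import structures.
From mathcomp Require Import all_boot all_order all_algebra.
From mathcomp Require Import complex.
From mathcomp Require Import ring lra.

Set Implicit Arguments.
Unset Strict Implicit.
Unset Printing Implicit Defensive.

Import Order.TTheory GRing.Theory Num.Theory.
Local Open Scope ring_scope.
Local Open Scope complex_scope.

(** * Sylvester's identity and values of characteristic polynomials *)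

(** Right multiplication by block triangular matrices clears [V], then [W], from [K]; nothing is
    divided by [t], which may be zero. *)
Lemma sylvester_det (S : comNzRingType) (m n : nat) (t : S)
    (W : 'M[S]_(n, m)) (V : 'M[S]_(m, n)) :
  t ^+ m * \det (t%:M - W *m V) = t ^+ n * \det (t%:M - V *m W).
Proof.
pose K := block_mx (t%:M : 'M_n) W V (1%:M : 'M_m).
have detK : \det K = \det (t%:M - W *m V).
  have: K *m block_mx 1%:M 0 (- V) 1%:M = block_mx (t%:M - W *m V) W 0 1%:M.
    by rewrite mulmx_block !(mulmx0, mulmx1, mul1mx) add0r mulmxN subrr add0r.
  move/(congr1 determinant); rewrite det_mulmx det_lblock det_ublock.
  by rewrite !det1 !mulr1.
have: K *m block_mx 1%:M (- W) 0 t%:M = block_mx t%:M 0 V (t%:M - V *m W).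
  rewrite mulmx_block !(mulmx0, mulmx1, mul1mx) !addr0 !mulmxN.
  by rewrite scalar_mxC addNr addrC.
move/(congr1 determinant); rewrite det_mulmx det_lblock det_ublock.
by rewrite !det_scalar !expr1n mul1r detK mulrC.
Qed.

Lemma horner_char_poly (S : comNzRingType) (m : nat) (A : 'M[S]_m) (x : S) :
  (char_poly A).[x] = \det (x%:M - A).
Proof.
rewrite /char_poly -horner_evalE -det_map_mx; congr determinant.
apply/matrixP=> i j.
by rewrite !mxE rmorphB rmorphMn /= /horner_eval hornerX hornerC.
Qed.

(** * Determinant of the block-cyclic matrix *)

Section Cycle.

Variables (R : rcfType) (d : nat) (n_ : 'I_d -> nat).
Variable A : forall i : 'I_d, 'M[R]_(n_ (ordS i), n_ i).
Variable i1 : 'I_d.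
Hypothesis i1E : i1 = 0%N :> nat.

Let n := (\sum_i n_ i)%N.

(* [chain_prod] has the right number of rows only up to [iter k ordS i1 = j],
   the junk value 0 spares every cast. *)
Let chain (k : nat) (j : 'I_d) : 'M[R]_(n_ j, n_ i1) :=
  conform_mx 0 (chain_prod A i1 k).

Lemma val_iter_ordS (k : nat) : (k < d)%N -> iter k (@ordS d) i1 = k :> nat.
Proof.
elim: k => [//|k IHk] ltkd; rewrite iterS /= IHk ?(ltnW ltkd) //.
by rewrite modn_small.
Qed.

Lemma iter_ordS_ord (j : 'I_d) : iter j (@ordS d) i1 = j.
Proof. by apply: val_inj; rewrite /= val_iter_ordS. Qed.

Let chainS (j : 'I_d) : chain j.+1 (ordS j) = A j *m chain j j.
Proof.
(* Once the exponent is abstracted from [j], the index equation can be eliminated and each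
   [conform_mx] meets equal dimensions. *)
rewrite /chain; move: (nat_of_ord j) (iter_ordS_ord j) => k e.
by case: j / e; rewrite !conform_mx_id.
Qed.

Let chain_full : chain d i1 = cycle_prod A i1.
Proof.
rewrite /chain /cycle_prod; move: (iter_ordS i1) => e.
by rewrite -(conform_castmx (congr1 n_ e, erefl (n_ i1))) conform_mx_id.
Qed.

Let N : 'M[R]_n := \mxblock_(i < d, j < d)
  (if (i == ordS j) && (i != i1)
   then conform_mx (0 : 'M[R]_(n_ i, n_ j)) (A j) else 0).

Let E : 'M[R]_(n, n_ i1) :=
  \mxcol_i (if i == i1 then conform_mx 0 (1%:M : 'M[R]_(n_ i1)) else 0).

Let V : 'M[R]_(n_ i1, n) :=
  \mxrow_j (if ordS j == i1 then conform_mx 0 (A j) else 0).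

(** For nonzero [x] this is x^d (x - N)^-1 E: block [i] of (x - N)^-1 E carries x^-(i+1), and x^d
    clears the denominators. *)
Let W (x : R) : 'M[R]_(n, n_ i1) := \mxcol_i (x ^+ (d.-1 - i) *: chain i i).

Lemma ordS_neq (j : 'I_d) : ordS j != i1 -> ordS j = j.+1 :> nat.
Proof.
rewrite -val_eqE /= i1E; have := ltn_ord j; rewrite leq_eqVlt.
by case/predU1P=> [->|lt _]; [rewrite modnn eqxx|rewrite modn_small].
Qed.

Lemma ordS_eq (j : 'I_d) : ordS j = i1 -> j.+1 = d.
Proof.
move/(congr1 val); rewrite /= i1E => e; apply/eqP; rewrite eqn_leq ltn_ord /=.
by apply: dvdn_leq => //; apply/eqP.
Qed.

Let block_cyclic_decomp : block_cyclic A = N + E *m V.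
Proof.
rewrite /block_cyclic /N /E /V mul_mxcol_mxrow -mxblockD.
apply: eq_mxblock => i j; have [->|nij] := eqVneq i (ordS j); last first.
  rewrite /= add0r; case: (eqVneq i i1) => [e|_]; last by rewrite mul0mx.
  by rewrite -e eq_sym (negPf nij) mulmx0.
case: (eqVneq (ordS j) i1) => [|_] /=; last by rewrite mul0mx addr0.
move: (ordS j) (A j) => k B e; case: i1 / e.
by rewrite !conform_mx_id mul1mx add0r.
Qed.

(** Without the wrap-around block the cyclic successor increases the index, so [N] is strictly lower
    triangular. *)
Let det_nilpotent (x : R) : \det (x%:M - N) = x ^+ n.
Proof.
have ltN (i j : 'I_d) : (i <= j)%N -> (i == ordS j) && (i != i1) = false.
  move=> leij; apply/negP=> /andP[/eqP e]; move: leij; rewrite e => + ni.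
  by rewrite ordS_neq // ltnn.
have trigN : is_trig_mx N.
  apply/is_trig_mxblockP; split=> [i j /ltnW lij|i]; first by rewrite ltN.
  by rewrite ltN // mx0_is_trig.
have -> : \det (x%:M - N) = (char_poly N).[x].
  by rewrite horner_char_poly.
rewrite char_poly_trig // horner_prod -[n in RHS]card_ord -prodr_const.
apply: eq_bigr => k _.
by rewrite !mxE ltN // mxE subr0 hornerX.
Qed.

(** Block row [i1] of [N] vanishes, which leaves x^d there; in any other row the two surviving terms
    cancel by [chainS]. *)
Let mulW (x : R) : (x%:M - N) *m W x = x ^+ d *: E.
Proof.
have d_gt0 : (0 < d)%N by apply: leq_ltn_trans (ltn_ord i1).
rewrite mulmxBl mul_scalar_mx {2}/W mul_mxblock_mxrow.
have -> : x *: W x = \mxcol_i (x ^+ (d - i) *: chain i i).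
  apply/matrixP=> a b; rewrite !mxE mulrA -exprS -subSn ?prednK //.
  by rewrite -ltnS prednK // ltn_ord.
have -> : x ^+ d *: E = \mxcol_i (x ^+ d *:
    (if i == i1 then conform_mx 0 (1%:M : 'M[R]_(n_ i1)) else 0)).
  by apply/matrixP=> a b; rewrite !mxE.
rewrite -mxcolB; apply: eq_mxcol => i; case: (eqVneq i i1) => [->|ni].
  rewrite i1E subn0 big1 ?subr0 //.
  by move=> j _; rewrite andbF mul0mx.
rewrite -(ord_predK i) in ni *; move: (ord_pred i) ni => j nj.
rewrite (bigD1 j) // big1 ?addr0 => [|k /andP[_ nk]].
  rewrite eqxx conform_mx_id andbT -scalemxAr -chainS (ordS_neq nj).
  by rewrite -subn1 -subnDA add1n /= addr0 subrr scaler0.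
case: eqP => [/(can_inj (@ordSK d)) e|_]; last by rewrite mul0mx.
by rewrite e eqxx in nk.
Qed.

(** The powers of [x] stay on both sides because [x] may be zero and n - d n_1 may be negative. *)
Lemma det_block_cyclic (x : R) :
  x ^+ (d * n + d * n_ i1) * \det (x%:M - block_cyclic A) =
  x ^+ (n + d * n) * \det ((x ^+ d)%:M - cycle_prod A i1).
Proof.
have fact : x ^+ d *: (x%:M - block_cyclic A) =
    (x%:M - N) *m ((x ^+ d)%:M - W x *m V).
  rewrite mulmxBr mulmxA mulW mul_mx_scalar -scalemxAl -scalerBr.
  by rewrite block_cyclic_decomp opprD addrA.
(* [V] is supported on the last block, where [W] has exponent 0, so exactly one full turn of the
   cycle remains. *)
have VW : V *m W x = cycle_prod A i1.
  have d_gt0 : (0 < d)%N by apply: leq_ltn_trans (ltn_ord i1).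
  have dE : d.-1.+1 = d by rewrite prednK.
  have ltd : (d.-1 < d)%N by rewrite dE.
  pose j := Ordinal ltd.
  rewrite /V /W mul_mxrow_mxcol (bigD1 j) //= big1 ?addr0; last first.
    move=> k nk; case: eqP => [/ordS_eq e|_]; last by rewrite mul0mx.
    by case/negP: nk; apply/eqP/val_inj/succn_inj; rewrite e dE.
  have e : ordS j = i1 by apply: val_inj; rewrite /= dE modnn i1E.
  rewrite subnn scale1r -chain_full; case: eqP => // _.
  have := chainS j; rewrite [X in chain X (ordS j)]dE.
  move: (A j) e; move: (ordS j) => k B e; subst k.
  by rewrite conform_mx_id.
have /(congr1 determinant) := fact; rewrite detZ det_mulmx det_nilpotent => e.
rewrite [(d * n + _)%N]addnC exprD -mulrA !exprM e mulrCA sylvester_det VW.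
by rewrite mulrA exprD exprM.
Qed.

End Cycle.

(** * Kemeny's constant as a logarithmic derivative *)

(** Naturals are distinct in [R], so a nonzero difference would have too many roots. *)
Lemma poly_ext (R : numDomainType) (p q : {poly R}) :
  (forall x, p.[x] = q.[x]) -> p = q.
Proof.
move=> pq; apply/eqP; rewrite -subr_eq0; apply/negPn/negP => nz.
pose rs := [seq k%:R : R | k <- iota 0 (size (p - q))].
have rs_roots : all (root (p - q)) rs.
  by apply/allP=> x _; rewrite rootE !hornerE pq subrr.
have rs_uniq : uniq rs.
  by rewrite map_inj_uniq ?iota_uniq // => a b /eqP; rewrite eqr_nat => /eqP.
by have := max_poly_roots nz rs_roots rs_uniq; rewrite size_map size_iota ltnn.
Qed.

(** X - Q multiplies the all-ones vector by X - 1; applying the adjugate and reading entry [j0]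
    gives the factorization. *)
Lemma char_poly_factor (S : comNzRingType) (N : nat) (Q : 'M[S]_N) (j0 : 'I_N) :
    Q *m (const_mx 1 : 'cV_N) = const_mx 1 ->
  exists2 q : {poly S}, char_poly Q = ('X - 1) * q
    & q.[1] = \sum_i cofactor (1%:M - Q) i j0.
Proof.
move=> Q1; pose T := char_poly_mx Q.
exists (\sum_i cofactor T i j0); last first.
  rewrite -horner_evalE rmorph_sum; apply: eq_bigr => i _.
  rewrite -cofactor_map_mx; congr cofactor; apply/matrixP=> a b.
  by rewrite !mxE rmorphB rmorphMn /= /horner_eval hornerX hornerC.
have T1 : T *m (const_mx 1 : 'cV_N) = const_mx ('X - 1).
  rewrite mulmxBl mul_scalar_mx.
  have -> : const_mx 1 = map_mx polyC (const_mx 1 : 'cV[S]_N).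
    by apply/matrixP=> a b; rewrite !mxE.
  by rewrite -map_mxM Q1; apply/matrixP=> a b; rewrite !mxE mulr1.
have /matrixP/(_ j0 0) : \adj T *m (T *m const_mx 1) =
    (char_poly Q)%:M *m (const_mx 1 : 'cV_N).
  by rewrite mulmxA mul_adj_mx.
rewrite T1 mul_scalar_mx !mxE mulr1 => <-; rewrite mulr_sumr.
by apply: eq_bigr => i _; rewrite !mxE mulrC.
Qed.

Lemma horner_deriv_prod_XsubC (F : fieldType) (s : seq F) (x : F) :
    x \notin s ->
  (\prod_(z <- s) ('X - z%:P))^`().[x] =
  (\prod_(z <- s) ('X - z%:P)).[x] * \sum_(z <- s) (x - z)^-1.
Proof.
elim: s => [|z s IHs]; first by rewrite !big_nil derivC hornerC mulr0.
rewrite inE negb_or => /andP[xz xs]; rewrite !big_cons derivM !hornerE IHs //.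
rewrite derivXsubC hornerC mul1r.
have : x - z != 0 by rewrite subr_eq0.
set u := _.[x]; set v := \sum_(_ <- _) _; set w := x - z => w0.
by rewrite mulrDr mulrAC divff // mul1r mulrA.
Qed.

(** As q(1) is nonzero, the eigenvalue 1 is simple, and deleting one occurrence leaves exactly the
    roots of [q]. *)
Lemma kemenyE (R : rcfType) (N : nat) (Q : 'M[R]_N) (q : {poly R}) :
    char_poly Q = ('X - 1) * q -> q.[1] != 0 ->
  kemeny Q = real_complex R (q^`().[1] / q.[1]).
Proof.
move=> Qq q1; rewrite /kemeny /eigenvalues.
case: closed_field_poly_normal => s /=.
rewrite (monicP (char_poly_monic _)) scale1r -map_char_poly Qq rmorphM.
rewrite rmorphB /= map_polyX rmorph1 => es.
set qC := map_poly (real_complex R) q in es.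
have qC1 : qC.[1] = real_complex R q.[1] by rewrite -horner_map rmorph1.
have nz1 : qC.[1] != 0 by rewrite qC1 fmorph_eq0.
have s1 : 1 \in s by rewrite -root_prod_XsubC -es rootM rootE !hornerE subrr eqxx.
have qCE : qC = \prod_(z <- rem 1 s) ('X - z%:P).
  apply: (@mulfI _ ('X - 1%:P)); first by rewrite polyXsubC_eq0.
  by rewrite es (perm_big _ (perm_to_rem s1)) big_cons.
have ns : 1 \notin rem 1 s by rewrite -root_prod_XsubC -qCE rootE.
have := horner_deriv_prod_XsubC ns; rewrite -qCE => e.
rewrite rmorphM fmorphV /= -qC1 -(rmorph1 (real_complex R)) -horner_map.
by rewrite -deriv_map rmorph1 e mulrC mulKf.
Qed.

(** * Simplicity of the eigenvalue 1 *)

(* Maximum principle at a maximal entry of [f]. *)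
Lemma shift_harmonic_le0 (R : rcfType) (N : nat) (Q : 'M[R]_N)
    (f : 'cV[R]_N) (c : R) :
    stochastic Q -> Q *m f = f + const_mx c -> (0 < N)%N ->
  exists2 i, forall j, f j 0 <= f i 0 & c <= 0.
Proof.
move=> [Q0 Q1] Qf N0; pose i0 := Ordinal N0.
have [i _ imax] := @arg_maxP _ _ _ i0 xpredT (fun j => f j 0) isT.
exists i => [j|]; first exact: imax.
have /matrixP/(_ i 0) := Qf; rewrite !mxE => e.
rewrite -(lerD2l (f i 0)) addr0 -e.
have /matrixP/(_ i 0) := Q1; rewrite !mxE => e1.
rewrite -[X in _ <= X]mul1r -e1 mulr_suml; apply: ler_sum => j _.
by rewrite mxE mulr1 ler_wpM2l ?Q0 //; apply: imax.
Qed.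

Lemma stochasticX (R : rcfType) (N : nat) (Q : 'M[R]_N) (k : nat) :
  stochastic Q -> stochastic (Q ^+ k).
Proof.
move=> [Q0 Q1]; elim: k => [|k [I0 I1]].
  by split=> [i j|]; rewrite ?mxE ?ler0n // mul1mx.
split=> [i j|]; last by rewrite exprS -mulmxA I1.
by rewrite exprS mxE sumr_ge0 // => l _; rewrite mulr_ge0.
Qed.

(** The maximal value is an average of [f] under row [i] of Q^k, so [f] attains it wherever the
    weight is positive; [k] is chosen to reach [j]. *)
Lemma irreducible_harmonic (R : rcfType) (N : nat) (Q : 'M[R]_N)
    (f : 'cV[R]_N) (i : 'I_N) :
    stochastic Q -> irreducible Q -> Q *m f = f ->
  (forall j, f j 0 <= f i 0) -> forall j, f j 0 = f i 0.
Proof.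
move=> Qs Qirr Qf imax j; have [k kij] := Qirr i j.
have Qkf : Q ^+ k *m f = f.
  by elim: k {kij} => [|k IHk]; rewrite ?mul1mx // exprS -mulmxA IHk.
have [Qk0 /matrixP/(_ i 0)] := stochasticX k Qs; rewrite !mxE => e1.
have /matrixP/(_ i 0) := Qkf; rewrite !mxE => ef.
have s0 : \sum_l (Q ^+ k) i l * (f i 0 - f l 0) = 0.
  under eq_bigr do rewrite mulrBr.
  rewrite sumrB ef -mulr_suml.
  have -> : \sum_l (Q ^+ k) i l = 1.
    by rewrite -[RHS]e1; apply: eq_bigr => l _; rewrite mxE mulr1.
  by rewrite mul1r subrr.
have := psumr_eq0P _ s0 (i := j) isT; move=> /(_ _)/eqP.
rewrite mulf_eq0 gt_eqF //= subr_eq0 => h; apply/esym/eqP/h => l _.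
by rewrite mulr_ge0 ?subr_ge0.
Qed.

(* The sum of cofactors is the value at 1 of [char_poly Q / ('X - 1)], and also
   the determinant of [1 - Q] with column [j0] replaced by ones. *)
Lemma irreducible_simple (R : rcfType) (N : nat) (Q : 'M[R]_N) (j0 : 'I_N) :
    stochastic Q -> irreducible Q ->
  \sum_i cofactor (1%:M - Q) i j0 != 0.
Proof.
move=> Qs Qirr.
pose B := \matrix_(i, j) (if j == j0 then 1 else (1%:M - Q) i j).
have -> : \sum_i cofactor (1%:M - Q) i j0 = \det B^T.
  rewrite det_tr (expand_det_col _ j0); apply: eq_bigr => i _.
  rewrite !mxE eqxx mul1r /cofactor; congr (_ * \det _).
  apply/matrixP=> a b.
  by rewrite !mxE [lift j0 b == j0]eq_sym (negPf (neq_lift _ _)).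
apply/det0P => -[v v0 /(congr1 trmx)]; rewrite trmx_mul trmxK trmx0 => Bv.
have N0 : (0 < N)%N by apply: leq_ltn_trans (ltn_ord j0).
pose f : 'cV[R]_N := \col_j (if j == j0 then 0 else v 0 j).
(* Coordinate [j0] of a kernel vector of [B] multiplies the column of ones, hence acts as the
   constant shift. *)
have Qf : Q *m f = f + const_mx (v 0 j0).
  apply/esym/eqP; rewrite addrC -subr_eq0 -addrA -{1}[f]mul1mx -mulmxBl -Bv.
  apply/eqP/matrixP => i k; rewrite !mxE (bigD1 j0) //= [in RHS](bigD1 j0) //=.
  rewrite !mxE eqxx mulr0 add0r mul1r ord1; congr (_ + _).
  by apply: eq_bigr => j /negPf nj; rewrite !mxE nj.
(* The maximum principle for [f] and [- f] kills the shift; [f] is then harmonic, hence constant,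
   and it vanishes at [j0]. *)
have [i imax c_le0] := shift_harmonic_le0 Qs Qf N0.
have [|_ _ c_ge0] := @shift_harmonic_le0 _ _ Q (- f) (- v 0 j0) Qs _ N0.
  by rewrite mulmxN Qf opprD; congr (_ + _); apply/matrixP=> a b; rewrite !mxE.
have c0 : v 0 j0 = 0 by apply/eqP; rewrite eq_le c_le0 -oppr_le0.
have Qf' : Q *m f = f by rewrite Qf c0; apply/matrixP=> a b; rewrite !mxE addr0.
have fconst := irreducible_harmonic Qs Qirr Qf' imax.
case/negP: v0; apply/eqP/rowP=> j; rewrite mxE.
have [->|nj] := eqVneq j j0; first exact: c0.
have := fconst j; rewrite -(fconst j0) !mxE eqxx (negPf nj); exact.
Qed.

(** * Transfer between the cycle product and the block-cyclic matrix *)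

Lemma cycle_prod_const (R : rcfType) (d : nat) (n_ : 'I_d -> nat)
    (A : forall i : 'I_d, 'M[R]_(n_ (ordS i), n_ i)) (i : 'I_d) :
    (forall j, A j *m (const_mx 1 : 'cV_(n_ j)) = const_mx 1) ->
  cycle_prod A i *m (const_mx 1 : 'cV_(n_ i)) = const_mx 1.
Proof.
move=> A1.
have chain1 k : chain_prod A i k *m (const_mx 1 : 'cV_(n_ i)) = const_mx 1.
  by elim: k => [|k IHk]; rewrite /= ?mul1mx // -mulmxA IHk A1.
rewrite /cycle_prod; move: (iter_ordS i) (chain_prod A i d) (chain1 d).
by move: (iter d _ i) => j e; subst j.
Qed.

Lemma char_poly_block_cyclic (R : rcfType) (d : nat) (n_ : 'I_d -> nat)
    (A : forall i : 'I_d, 'M[R]_(n_ (ordS i), n_ i)) (i1 : 'I_d) :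
    i1 = 0%N :> nat ->
  let n := (\sum_i n_ i)%N in
  'X^(d * n + d * n_ i1) * char_poly (block_cyclic A) =
  'X^(n + d * n) * (char_poly (cycle_prod A i1) \Po 'X^d).
Proof.
move=> i1E n; apply: poly_ext => x.
rewrite !hornerM horner_comp !hornerXn !horner_char_poly.
exact: det_block_cyclic.
Qed.

Lemma sum_ord_natr (F : numFieldType) (d : nat) :
  \sum_(i < d) i%:R = d%:R * (d%:R - 1) / 2 :> F.
Proof.
elim: d => [|d IHd]; first by rewrite big_ord0 !mul0r.
by rewrite big_ord_recr /= IHd -addn1 natrD; field.
Qed.

(* Comparing values and derivatives at 1, after division by [X - 1]. *)
Lemma log_deriv_subst (F : numFieldType) (a b d : nat) (p q : {poly F}) :
    'X^a * (('X - 1) * p) = 'X^b * ((('X - 1) * q) \Po 'X^d) -> (0 < d)%N ->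
    p.[1] != 0 ->
  q.[1] != 0 /\
  a%:R + p^`().[1] / p.[1] =
  b%:R + (d%:R - 1) / 2 + d%:R * (q^`().[1] / q.[1]).
Proof.
move=> e d_gt0 p1; pose s : {poly F} := \sum_(i < d) 'X^i.
(* Since X^d - 1 = (X - 1) [s], the factor X - 1 cancels. *)
have {}e : 'X^a * p = 'X^b * (s * (q \Po 'X^d)).
  apply: (@mulfI _ ('X - 1)); first by rewrite -polyC1 polyXsubC_eq0.
  rewrite mulrCA e comp_polyM comp_polyB comp_polyX -polyC1 comp_polyC subrX1.
  by rewrite -mulrA mulrCA.
have s1 : s.[1] = d%:R.
  rewrite horner_sum (eq_bigr (fun=> 1)) ?sumr_const ?card_ord // => i _.
  by rewrite hornerXn expr1n.
(* With s(1) = d, this is the source of the term (d - 1)/2. *)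
have s'1 : s^`().[1] = d%:R * (d%:R - 1) / 2.
  rewrite -sum_ord_natr raddf_sum horner_sum; apply: eq_bigr => i _.
  by rewrite /= derivXn hornerMn hornerXn expr1n.
have /(congr1 (horner^~ 1)) := e.
rewrite !hornerM horner_comp !hornerXn !expr1n !mul1r s1 => pE.
have /(congr1 (fun r => r^`().[1])) := e.
rewrite !derivM deriv_comp !derivXn !hornerE !horner_comp !hornerMn !hornerXn.
rewrite !expr1n s1 s'1 pE => e'.
have d0 : d%:R != 0 :> F by rewrite pnatr_eq0 -lt0n.
have q1 : q.[1] != 0 by apply: contraNneq p1 => q0; rewrite pE q0 mulr0.
split=> //.
apply: (@mulfI _ (d%:R * q.[1])); first by rewrite mulf_neq0.
rewrite -pE mulrDr mulrCA divff // mulr1 pE.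
move: e'; rewrite /= !mul1r mulrC => ->.
by field.
Qed.

Theorem theorem4p2 (R : rcfType) (d : nat) (d_ge2 : (2 <= d)%N)
    (n_ : 'I_d -> nat) (n_gt0 : forall i : 'I_d, (0 < n_ i)%N)
    (A : forall i : 'I_d, 'M[R]_(n_ (ordS i), n_ i))
    (A_stochastic : forall i : 'I_d, stochastic (A i))
    (P_stochastic : stochastic (block_cyclic A))
    (P_irreducible : irreducible (block_cyclic A))
    (P_periodic : periodic (block_cyclic A)) :
  let P := block_cyclic A in
  let i1 : 'I_d := Ordinal (ltnW d_ge2) in
  let n : nat := (\sum_i n_ i)%N in
  kemeny P =
    d%:R * kemeny (cycle_prod A i1) + n%:R - d%:R * (n_ i1)%:R
      + (d%:R - 1) / 2
  /\
  ((forall i j : 'I_d, n_ i = n_ j) ->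
   kemeny P = d%:R * kemeny (cycle_prod A i1) + (d%:R - 1) / 2).
Proof.
move=> P i1 n.
suff kP : kemeny P = d%:R * kemeny (cycle_prod A i1) + n%:R
    - d%:R * (n_ i1)%:R + (d%:R - 1) / 2.
  split=> // n_eq; rewrite kP; suff -> : n = (d * n_ i1)%N by rewrite natrM addrK.
  by rewrite /n (eq_bigr (fun=> n_ i1)) // sum_nat_const card_ord.
have n0 : (0 < n)%N by rewrite /n (bigD1 i1) //= addn_gt0 n_gt0.
have [p pE p1] := char_poly_factor (Ordinal n0) P_stochastic.2.
have [q qE _] := char_poly_factor (Ordinal (n_gt0 i1))
  (cycle_prod_const i1 (fun j => (A_stochastic j).2)).
have {}p1 : p.[1] != 0 by rewrite p1 irreducible_simple.
have := @char_poly_block_cyclic _ _ _ A i1 erefl; rewrite pE qE => e.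
(* Simplicity of the eigenvalue 1 passes from [P] to the cycle product through p(1) = d q(1). *)
have [q1 kE] := log_deriv_subst e (ltnW d_ge2) p1.
rewrite (kemenyE pE p1) (kemenyE qE q1).
have -> : p^`().[1] / p.[1] = d%:R * (q^`().[1] / q.[1]) + n%:R
    - d%:R * (n_ i1)%:R + (d%:R - 1) / 2.
  (* The common d n in both exponents cancels, leaving n - d n_1. *)
  by move: kE; rewrite -/n !natrD !natrM => kE; lra.
rewrite !rmorphD !rmorphN !rmorphM !fmorphV /= rmorphB.
by rewrite !rmorph_nat rmorph1.
Qed.
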